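(* Let $G$ be a finite complete group, let $g\in G$ be an involution, and let $G_2$ be the set of all involutions of $G$. Then $G$ is a restricted GCI-group if and only if both of the following hold: (i) $G_2=C(g)$, where $C(g)$ is the conjugacy class of $g$ in $G$; and (ii) for any generalized Cayley subsets $S_1$ and $S_2$ of $G$ induced by $\sigma(g)$, $GC(G,S_1,\sigma(g))\cong GC(G,S_2,\sigma(g))$ implies that there exists $\sigma(x)\in\mathrm{Aut}(G)$ (with $x\in G$) such that $gS_2=(gS_1)^{\sigma(x)}$.
   Context: A group $G$ is complete if $Z(G)=\{e\}$ and $\mathrm{Aut}(G)=\mathrm{Inn}(G)$. An involution is an element of order $2$. For $y\in G$ and $\alpha\in\mathrm{Aut}(G)$, $y^\alpha$ denotes the image of $y$ under $\alpha$; for $S\subseteq G$, $S^\alpha=\{s^\alpha\mid s\in S\}$ and $gS=\{gs\mid s\in S\}$. Products of automorphisms act by $y^{\beta\alpha}=(y^\alpha)^\beta$. For $x\in G$, $\sigma(x)$ is the inner automorphism $h\mapsto xhx^{-1}$. Generalized Cayley graphs: given a finite group $G$, an automorphism $\alpha\in\mathrm{Aut}(G)$ and $S\subseteq G$, suppose (a) $\alpha^2=\mathrm{id}$; (b) for every $y\in G$, $(y^{-1})^\alpha y\notin S$; (c) for all $y,h\in G$, if $(h^{-1})^\alpha y\in S$ then $(y^{-1})^\alpha h\in S$. Then $S$ is called a generalized Cayley subset of $G$ induced by $\alpha$, and $GC(G,S,\alpha)$ is the graph with vertex set $G$ and edge set $\{\{y,h\}\mid (y^{-1})^\alpha h\in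 S\}$. A finite group $G$ is a restricted GCI-group if for any two generalized Cayley graphs $X_i=GC(G,S_i,\alpha_i)$ $(i=1,2)$ of $G$ with both $\alpha_1$ and $\alpha_2$ of order $2$ in $\mathrm{Aut}(G)$, $X_1\cong X_2$ implies that there exist $y\in G$ and $\gamma\in\mathrm{Aut}(G)$ such that $\alpha_2=\gamma\alpha_1\gamma^{-1}$ and $S_2=y^{\alpha_2}S_1^\gamma y^{-1}$. *)

(* Defs.v *)
From mathcomp Require Import all_boot all_fingroup all_solvable.

Set Implicit Arguments.
Unset Strict Implicit.
Unset Printing Implicit Defensive.

Local Open Scope group_scope.

Record graph (T : finType) := Graph {
  vertices : {set T};
  edges : {set {set T}}
}.

Definition isomorphic (T T' : finType) (X : graph T) (Y : graph T') : Prop :=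
  exists f : T -> T',
    [/\ {in vertices X &, injective f},
        f @: vertices X = vertices Y
      & {in vertices X &, forall u v,
           ([set u; v] \in edges X) = ([set f u; f v] \in edges Y)}].

Section GroupDefs.

Variables (gT : finGroupType) (G : {group gT}).

(* MathComp's conj_aut G x is h |-> h ^ x = x^-1 * h * x on G, hence the
   inverse (see sigmaE). *)
Definition sigma (x : gT) : {perm gT} := conj_aut G x^-1.

Lemma sigmaE : {in G &, forall x h, sigma x h = x * h * x^-1}.
Proof.
by move=> x h Gx Gh; rewrite /sigma conj_autE ?groupV // conjgE invgK mulgA.
Qed.

Definition Inn : {set {perm gT}} := [set sigma x | x in G].

Definition complete : Prop := 'Z(G) = 1 /\ Aut G = Inn.

Definition involutions : {set gT} := [set x in G | #[x] == 2].

Definition generalized_Cayley_subset (S : {set gT}) (alpha : {perm gT}) : Prop :=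
  [/\ S \subset G, alpha \in Aut G & alpha ^+ 2 = 1]
  /\ {in G, forall y, alpha y^-1 * y \notin S}
  /\ {in G &, forall y h, alpha h^-1 * y \in S -> alpha y^-1 * h \in S}.

Definition GC (S : {set gT}) (alpha : {perm gT}) : graph gT :=
  Graph G [set e | [exists y in G, exists h in G,
                      (e == [set y; h]) && (alpha y^-1 * h \in S)]].

(* Permutations compose left to right in MathComp, so the automorphism
   y |-> gamma (alpha1 (gamma^-1 y)), written gamma alpha1 gamma^-1 when
   automorphisms compose right to left, is gamma^-1 * alpha1 * gamma here. *)
Definition restricted_GCI : Prop :=
  forall (S1 S2 : {set gT}) (alpha1 alpha2 : {perm gT}),
    #[alpha1] = 2 -> #[alpha2] = 2 ->
    generalized_Cayley_subset S1 alpha1 ->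
    generalized_Cayley_subset S2 alpha2 ->
    isomorphic (GC S1 alpha1) (GC S2 alpha2) ->
    exists y gamma,
      [/\ y \in G, gamma \in Aut G, alpha2 = gamma^-1 * alpha1 * gamma
        & S2 = alpha2 y *: (gamma @: S1) :* y^-1].

End GroupDefs.

(* Main.v *)
(** In a complete group every automorphism is conjugation by a unique element,
    so the automorphisms of order 2 are the [sigma G h] with [h] an involution.
    Empty connection sets give isomorphic graphs for all of these automorphisms,
    which forces all involutions to be conjugate.  Since [g ^+ 2 = 1], twisting
    [S] to [(sigma G g y) S y^-1] amounts to conjugating [g S] by [y], and this
    identifies the two notions of equivalence when both automorphisms are
    [sigma G g]; conjugation reduces the general case to this one. *)
Require Import Defs.
From mathcomp Require Import all_boot all_fingroup all_solvable.

Set Implicit Arguments.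
Unset Strict Implicit.
Unset Printing Implicit Defensive.

Local Open Scope group_scope.

Lemma isomorphic_trans (T1 T2 T3 : finType)
    (X : graph T1) (Y : graph T2) (Z : graph T3) :
  isomorphic X Y -> isomorphic Y Z -> isomorphic X Z.
Proof.
move=> [f [injf imf edgef]] [h [injh imh edgeh]]; exists (h \o f).
have fV u : u \in vertices X -> f u \in vertices Y.
  by move=> Xu; rewrite -imf imset_f.
split.
- by move=> u v Xu Xv /= /injh eq_f; apply: injf => //; apply: eq_f; apply: fV.
- by rewrite imset_comp imf.
by move=> u v Xu Xv /=; rewrite edgef // edgeh ?fV.
Qed.

Section Complete.

Variables (gT : finGroupType) (G : {group gT}).
Implicit Types (S A : {set gT}) (alpha : {perm gT}) (x y g : gT).

Lemma conj_aut_imset A x :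
  x \in G -> A \subset G -> conj_aut G x @: A = A :^ x.
Proof.
move=> Gx /subsetP sAG; rewrite /conjugate.
apply: eq_in_imset => a /sAG Ga; exact: conj_autE.
Qed.

Lemma sigma_imset A x :
  x \in G -> A \subset G -> sigma G x @: A = A :^ x^-1.
Proof. by move=> Gx; apply: conj_aut_imset; rewrite groupV. Qed.

Lemma sigma_Aut x : sigma G x \in Aut G.
Proof. exact: Aut_aut. Qed.

Lemma sigma_conj x y : x \in G -> y \in G ->
  sigma G (y ^ x) = (conj_aut G x)^-1 * sigma G y * conj_aut G x.
Proof.
move=> Gx Gy; have NG := subsetP (normG G); rewrite /sigma -conjVg conjgE.
by rewrite !morphM ?morphV ?NG ?groupM ?groupV // mulgA.
Qed.

Lemma twist_conj g y A : g \in involutions G -> y \in G ->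
  g *: (sigma G g y *: A :* y^-1) = (g *: A) :^ y^-1.
Proof.
rewrite inE => /andP[Gg /eqP og] Gy.
have g2 : g * g = 1 by rewrite -[RHS](expg_order g) og.
have gV : g^-1 = g by apply/eqP; rewrite eq_invg_mul g2.
by rewrite sigmaE // gV conjsgE invgK !mulgA !mulg_set1 !mulgA g2 mul1g.
Qed.

(** An edge is an unordered pair, so [[set u; v]] may arise from [(u, v)] or from [(v, u)];
    condition (c) makes the two membership tests agree. *)
Lemma GC_edge S alpha : generalized_Cayley_subset G S alpha ->
  {in G &, forall u v,
     ([set u; v] \in edges (GC G S alpha)) = (alpha u^-1 * v \in S)}.
Proof.
move=> [_ [_ symS]] u v Gu Gv; rewrite inE; apply/idP/idP; last first.
  by move=> Suv; apply/existsP; exists u; rewrite Gu; apply/existsP; exists v;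
     rewrite Gv eqxx.
case/existsP=> y /andP[Gy /existsP[h /andP[Gh /andP[/eqP uv_yh Syh]]]].
have: u \in [set y; h] by rewrite -uv_yh set21.
have: v \in [set y; h] by rewrite -uv_yh set22.
have: y \in [set u; v] by rewrite uv_yh set21.
have: h \in [set u; v] by rewrite uv_yh set22.
have Shy := symS _ _ Gh Gy Syh.
rewrite !inE => /pred2P[]hE /pred2P[]yE /pred2P[]vE /pred2P[]uE;
  by subst; rewrite ?uE ?vE in Syh Shy *.
Qed.

Section Transport.

Variables (S : {set gT}) (alpha : {perm gT}) (x : gT).
Hypothesis (Gx : x \in G).
Let gamma := conj_aut G x.
Hypothesis (gcS : generalized_Cayley_subset G S alpha).

Let beta := gamma^-1 * alpha * gamma.

(** Since [beta] is [alpha] conjugated by [gamma], it sends [w ^ x] to [(alpha w) ^ x]; the whole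
    test is thus conjugated by [x]. *)
Let mem_transport u v : u \in G -> v \in G ->
  (beta (u ^ x)^-1 * v ^ x \in S :^ x) = (alpha u^-1 * v \in S).
Proof.
have [[_ Aalpha _] _] := gcS; move=> Gu Gv; rewrite -conjVg /beta !permM.
have ->: gamma^-1 (u^-1 ^ x) = u^-1.
  by rewrite -(conj_autE Gx) ?groupV // permK.
rewrite conj_autE ?(Aut_closed Aalpha) ?groupV //.
by rewrite -conjMg memJ_conjg.
Qed.

Let GJ u : u \in G -> exists2 w, w \in G & u = w ^ x.
Proof. by move=> Gu; exists (u ^ x^-1); rewrite ?conjgKV // groupJ ?groupV. Qed.

Lemma generalized_Cayley_subset_conj :
  generalized_Cayley_subset G (S :^ x) beta.
Proof.
have [[sSG Aalpha alpha2] [irrS symS]] := gcS.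
split; [split | split].
- by rewrite -(conjGid Gx) conjSg.
- by rewrite /beta !groupM ?groupV ?Aut_aut.
- by rewrite /beta -mulgA -conjgE -conjXg alpha2 conj1g.
- by move=> _ /GJ[u Gu ->]; rewrite mem_transport ?irrS.
by move=> _ _ /GJ[u Gu ->] /GJ[v Gv ->]; rewrite !mem_transport //; apply: symS.
Qed.

Lemma isomorphic_GC_conj : isomorphic (GC G S alpha) (GC G (S :^ x) beta).
Proof.
exists (conjg^~ x); split=> [u v _ _ /conjg_inj // | | u v Gu Gv].
  exact: conjGid.
rewrite !GC_edge ?groupJ ?mem_transport //.
exact: generalized_Cayley_subset_conj.
Qed.

End Transport.

(** The backward isomorphism is transport along [x^-1], so symmetry of [isomorphic] is never
    invoked. *)
Lemma isomorphic_GC_conjV S alpha x :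
    x \in G -> generalized_Cayley_subset G S alpha ->
  isomorphic (GC G (S :^ x) ((conj_aut G x)^-1 * alpha * conj_aut G x))
             (GC G S alpha).
Proof.
move=> Gx gcS; have Gx' : x^-1 \in G by rewrite groupV.
have := isomorphic_GC_conj Gx' (generalized_Cayley_subset_conj Gx gcS).
rewrite conjsgK morphV ?(subsetP (normG G)) // invgK.
by rewrite !mulgA mulgV mul1g mulgK.
Qed.

Lemma generalized_Cayley_subset0 alpha :
  alpha \in Aut G -> #[alpha] = 2 -> generalized_Cayley_subset G set0 alpha.
Proof.
move=> Aalpha oalpha; split; first by rewrite sub0set -oalpha expg_order.
by split=> [y _ | y h _ _]; rewrite inE.
Qed.

Lemma isomorphic_GC0 alpha beta :
  isomorphic (GC G set0 alpha) (GC G set0 beta).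
Proof.
exists id; split=> //; first exact: imset_id.
by move=> u v _ _; rewrite !inE; apply: eq_existsb => y; congr (_ && _);
   apply: eq_existsb => h; rewrite !inE.
Qed.

Hypothesis cplG : complete G.

(** On the normaliser of [G], [conj_aut G] has kernel ['C(G)]; restricting to [G] cuts this down to
    ['Z(G)], which is trivial. *)
Let f := restrm (normG G) (conj_aut G).

Let inj_f : 'injm f.
Proof. by have [Z1 _] := cplG; rewrite ker_restrm ker_conj_aut -Z1. Qed.

Lemma sigma_inj : {in G &, injective (sigma G)}.
Proof.
by move=> x y Gx Gy /(injmP inj_f) eq_xy; apply/invg_inj/eq_xy; rewrite groupV.
Qed.

Lemma order_sigma x : x \in G -> #[sigma G x] = #[x].
Proof.
by move=> Gx; rewrite -[RHS]orderV -(order_injm inj_f) ?groupV.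
Qed.

Lemma complete_AutP alpha :
  alpha \in Aut G -> exists2 x, x \in G & alpha = conj_aut G x.
Proof.
have [_ ->] := cplG; case/imsetP=> x Gx ->.
by exists x^-1; rewrite ?groupV.
Qed.

End Complete.

Theorem theorem4p8 (gT : finGroupType) (G : {group gT}) (g : gT) :
  complete G -> g \in involutions G ->
  restricted_GCI G <->
  involutions G = g ^: G /\
  (forall S1 S2 : {set gT},
     generalized_Cayley_subset G S1 (sigma G g) ->
     generalized_Cayley_subset G S2 (sigma G g) ->
     isomorphic (GC G S1 (sigma G g)) (GC G S2 (sigma G g)) ->
     exists x, [/\ x \in G, sigma G x \in Aut G
                 & g *: S2 = sigma G x @: (g *: S1)]).
Proof.
move=> cplG invg; have /[!inE] /andP[Gg /eqP og] := invg.
split=> [gciG | [invE gci_g]].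
  split=> [|S1 S2 gcS1 gcS2 isoS].
    apply/setP=> h; apply/idP/imsetP => [|[x Gx ->]]; last first.
      by rewrite inE groupJ // orderJ og.
    rewrite inE => /andP[Gh /eqP oh].
    have osg : #[sigma G g] = 2 by rewrite order_sigma.
    have osh : #[sigma G h] = 2 by rewrite order_sigma.
    have [] := gciG set0 set0 _ _ osg osh.
    - exact: generalized_Cayley_subset0 (sigma_Aut _ _) osg.
    - exact: generalized_Cayley_subset0 (sigma_Aut _ _) osh.
    - exact: isomorphic_GC0.
    (* With [gamma] conjugation by [x], the relation between the automorphisms reads
       [sigma G h = sigma G (g ^ x)], so [h = g ^ x]. *)
    move=> _ [gamma [_ /(complete_AutP cplG)[x Gx ->] hE _]]; exists x => //.
    by apply: (sigma_inj cplG); rewrite ?groupJ // sigma_conj.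
  have osg : #[sigma G g] = 2 by rewrite order_sigma.
  have [y [gamma []]] := gciG _ _ _ _ osg osg gcS1 gcS2 isoS.
  move=> Gy /(complete_AutP cplG)[x Gx ->]; rewrite -sigma_conj // => gE.
  (* Both automorphisms are [sigma G g], so [x] centralises [g]; hence [g *: (S1 :^ x)] is
     [(g *: S1) :^ x]. *)
  have {}gE : g = g ^ x by apply: (sigma_inj cplG) gE; rewrite ?groupJ.
  have sS1G : S1 \subset G by case: gcS1 => -[].
  (* First [gamma], which is [sigma G x^-1], then the twist by [y], which acts on [g *: S1] as
     [sigma G y]. *)
  rewrite conj_aut_imset // => ->; exists (y * x^-1).
  rewrite groupM ?groupV // sigma_Aut; split=> //.
  rewrite twist_conj // sigma_imset ?groupM ?groupV //; last first.
    by rewrite -(lcoset_id Gg) mulgS.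
  by rewrite {1}gE -conjg_set1 -conjsMg -conjsgM invMg invgK.
move=> S1 S2 alpha1 alpha2 o1 o2 gcS1 gcS2 isoS.
(* Condition (i) enters here: [alpha] is [sigma G] of an involution, hence of some [g ^ x], and
   conjugating back yields [sigma G g]. *)
have sigmaP S alpha : #[alpha] = 2 -> generalized_Cayley_subset G S alpha ->
    exists2 x, x \in G & sigma G g = (conj_aut G x)^-1 * alpha * conj_aut G x.
  move=> oalpha [[_ /(complete_AutP cplG)[h Gh alphaE] _] _].
  have {}alphaE : alpha = sigma G h^-1 by rewrite /sigma invgK.
  have: h^-1 \in involutions G.
    by rewrite inE groupV Gh -(order_sigma cplG) ?groupV // -alphaE oalpha.
  rewrite invE => /imsetP[x Gx hE]; exists x^-1; rewrite ?groupV //.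
  by rewrite alphaE hE -sigma_conj ?groupJ ?groupV // conjgK.
have [x1 Gx1 g1] := sigmaP _ _ o1 gcS1; have [x2 Gx2 g2] := sigmaP _ _ o2 gcS2.
have gcT1 := generalized_Cayley_subset_conj Gx1 gcS1.
have gcT2 := generalized_Cayley_subset_conj Gx2 gcS2.
have isoT1 := isomorphic_GC_conjV Gx1 gcS1.
have isoT2 := isomorphic_GC_conj Gx2 gcS2.
have isoT := isomorphic_trans (isomorphic_trans isoT1 isoS) isoT2.
rewrite -g1 -g2 in gcT1 gcT2 isoT.
have [x [Gx _]] := gci_g _ _ gcT1 gcT2 isoT.
have sS1G : S1 \subset G by case: gcS1 => -[].
have sT1G : S1 :^ x1 \subset G by case: gcT1 => -[].
(* Reading [twist_conj] backwards and cancelling [g] expresses [S2 :^ x2] as the twist of [S1 :^ x1]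
   by [x]. *)
rewrite sigma_imset -?(twist_conj _ invg) //; last by rewrite -(lcoset_id Gg) mulgS.
move/lcoset_inj=> T2E.
have NG := subsetP (normG G).
have alpha2E : alpha2 = conj_aut G x2 * sigma G g * (conj_aut G x2)^-1.
  by rewrite g2 !mulgA mulgV mul1g mulgK.
(* Conjugation by [x1] takes [alpha1] to [sigma G g], and by [x2^-1] takes that on to [alpha2]; the
   twisting element [x] follows only the second move. *)
exists (x ^ x2^-1), (conj_aut G (x1 * x2^-1)); split.
- by rewrite groupJ ?groupV.
- exact: Aut_aut.
- rewrite alpha2E g1 morphM ?morphV ?NG ?groupV // invMg invgK.
  by rewrite !mulgA.
rewrite conj_aut_imset ?groupM ?groupV // -[LHS](conjsgK x2) T2E.
rewrite !conjsMg !conjg_set1 conjVg conjsgM; congr (_ *: _ :* _).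
rewrite alpha2E !permM -morphV ?NG // !conj_autE ?groupV ?groupJ ?groupV //.
by rewrite conjgKV.
Qed.
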